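(* In the directed cut-matching game on $n$ vertices there is a cut player strategy such that, after $O(\log^2 n)$ rounds, the union of the directed matchings played by the matching player is an Eulerian graph with edge expansion $\Omega(\log n)$, regardless of the matching player's choices.
   Context: The directed cut-matching game on a vertex set $V$ with $|V|=n$ ($n$ even) starts from the empty graph. In each round the cut player chooses a bisection $(S,\overline S)$ of $V$, and the matching player then chooses a directed perfect matching between $S$ and $\overline S$, i.e. a directed graph whose edges go between $S$ and $\overline S$ and in which every vertex has in-degree exactly one and out-degree exactly one (hence it is Eulerian). The union of the matchings is the multigraph of all edges played. The edge expansion of a directed (multi)graph $H$ on $V$ is $\min_{\emptyset\neq S\subsetneq V}\frac{\min\{|\delta_H^+(S)|,|\delta_H^-(S)|\}}{\min\{|S|,|\overline S|\}}$, where $\delta^+_H(S)$ (resp. $\delta^-_H(S)$) is the multiset of edges of $H$ leaving (resp. entering) $S$. *)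

(* Defs.v *)
From HB Require Import structures.
From mathcomp Require Import all_boot all_order all_algebra all_fingroup.
From mathcomp Require Import all_classical all_reals.
From mathcomp Require Import exp.
Set Implicit Arguments. Unset Strict Implicit. Unset Printing Implicit Defensive.
Import Order.TTheory GRing.Theory Num.Theory.

Local Open Scope ring_scope.

(* Vertex set V = 'I_n.
   A directed perfect matching (every vertex has in-degree 1 and out-degree 1)
   is a permutation sigma : the unique edge leaving x is x -> sigma x.
   A played multigraph (union of matchings) is the sequence of its matchings. *)

Definition bisection (n : nat) (S : {set 'I_n}) : bool := (#|S|.*2 == n)%N.

Definition dmatching_between (n : nat) (S : {set 'I_n}) (M : {perm 'I_n}) : bool :=
  [forall x, (x \in S) != (M x \in S)].

(* Multiset of edges of the union H leaving / entering S: pairs (round i, tail x). *)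
Definition out_cut (n : nat) (H : seq {perm 'I_n}) (S : {set 'I_n}) : nat :=
  \sum_(M <- H) #|[set x | (x \in S) && (M x \notin S)]|.
Definition in_cut (n : nat) (H : seq {perm 'I_n}) (S : {set 'I_n}) : nat :=
  \sum_(M <- H) #|[set x | (x \notin S) && (M x \in S)]|.

Definition outdeg (n : nat) (H : seq {perm 'I_n}) (v : 'I_n) : nat :=
  \sum_(M <- H) #|[set x | x == v]|.
Definition indeg (n : nat) (H : seq {perm 'I_n}) (v : 'I_n) : nat :=
  \sum_(M <- H) #|[set x | M x == v]|.
Definition eulerian (n : nat) (H : seq {perm 'I_n}) : Prop :=
  forall v, indeg H v = outdeg H v.

(* Edge expansion: min over nonempty proper S of
   min(|delta^+(S)|, |delta^-(S)|) / min(|S|, |~S|), as an extended real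
   (the empty minimum is +oo, only relevant when n <= 1). *)
Definition edge_expansion (R : realType) (n : nat) (H : seq {perm 'I_n}) : \bar R :=
  (\big[Order.min/+oo%E]_(S : {set 'I_n} | (S != finset.set0) && (S != [set: 'I_n]%SET))
     (((minn (out_cut H S) (in_cut H S))%:R / (minn #|S| #|~: S|)%:R : R)%:E))%E.

(* A cut player strategy maps the history of matchings played so far to a set S
   (required to be a bisection). *)
Definition cut_strategy (n : nat) := seq {perm 'I_n} -> {set 'I_n}.

Definition legal_play (n : nat) (cs : cut_strategy n) (T : nat) (ms : seq {perm 'I_n}) : Prop :=
  size ms = T /\
  forall i, (i < T)%N -> dmatching_between (cs (take i ms)) (nth 1%g ms i).

(* Main.v *)
Require Import Defs.
From HB Require Import structures.
From mathcomp Require Import all_boot all_order all_algebra all_fingroup.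
From mathcomp Require Import all_classical all_reals.
From mathcomp Require Import exp.
From mathcomp Require Import zify ring lra.
Import Order.TTheory GRing.Theory Num.Theory.
Local Open Scope ring_scope.

Set Implicit Arguments.
Unset Strict Implicit.
Unset Printing Implicit Defensive.

(** It suffices to force constant expansion in [O(log n)] rounds: repeating such
    a phase [Theta(log n)] times adds up the cuts.

    Call [S] sparse if it has at most [n/2] vertices and at most [|S|/4] leaving
    edges (as many as entering ones, the matchings being permutations).  The cut
    player always plays a bisection containing a largest sparse set [U].  Give
    each vertex [v] a law [p_v], initially the Dirac mass at [v], and replace
    [p_v] by the average of [p_v] and [p_(M v)] when [M] is played.  The mass
    that [p_v], [v] in [S], puts outside [S] sums to at most half the number of
    edges leaving [S].  Hence if [|U| >= n/8], the matching averages laws that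
    are nearly supported on [U] and on its complement, and the total entropy
    grows by [Omega(n)]; as it is at most [n ln n], after [O(log n)] rounds
    [|U| < n/8].  One more round, which matches [U] to vertices outside [U],
    makes the graph an expander by maximality of [U]. *)

(** * Cuts in unions of matchings *)

Lemma card_perm_cut n (M : {perm 'I_n}) (S : {set 'I_n}) :
  #|[set x | (x \notin S) && (M x \in S)]| =
  #|[set x | (x \in S) && (M x \notin S)]|.
Proof.
pose A : {set 'I_n} := [set x | M x \in S].
have cA : #|A| = #|S|.
  rewrite -(card_preimset S (@perm_inj _ M)).
  by apply: eq_card => x; rewrite !inE.
have -> : [set x | (x \notin S) && (M x \in S)] = A :\: S.
  by apply/finset.setP => x; rewrite !inE.
have -> : [set x | (x \in S) && (M x \notin S)] = S :\: A.
  by apply/finset.setP => x; rewrite !inE andbC.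
by rewrite !cardsD cA finset.setIC.
Qed.

Lemma in_cutE n (H : seq {perm 'I_n}) (S : {set 'I_n}) :
  in_cut H S = out_cut H S.
Proof. by apply: eq_bigr => M _; exact: card_perm_cut. Qed.

Lemma out_cutC n (H : seq {perm 'I_n}) (S : {set 'I_n}) :
  out_cut H (~: S) = out_cut H S.
Proof.
rewrite -in_cutE; apply: eq_bigr => M _.
by apply: eq_card => x; rewrite !inE !negbK.
Qed.

Lemma out_cutU n (H : seq {perm 'I_n}) (A B : {set 'I_n}) :
  (out_cut H (A :|: B) <= out_cut H A + out_cut H B)%N.
Proof.
rewrite /out_cut -big_split /=; apply: leq_sum => M _.
apply: leq_trans (leq_card_setU _ _); apply/subset_leq_card/fintype.subsetP => x.
by rewrite !inE; case: (x \in A); case: (x \in B); case: (M x \in A);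
  case: (M x \in B).
Qed.

Lemma out_cut_cat n (H1 H2 : seq {perm 'I_n}) (S : {set 'I_n}) :
  out_cut (H1 ++ H2) S = (out_cut H1 S + out_cut H2 S)%N.
Proof. by rewrite /out_cut big_cat. Qed.

Lemma out_cut_rcons n (H : seq {perm 'I_n}) M (S : {set 'I_n}) :
  out_cut (rcons H M) S =
  (out_cut H S + #|[set x | (x \in S) && (M x \notin S)]|)%N.
Proof. by rewrite -cats1 out_cut_cat /out_cut big_seq1. Qed.

Lemma union_of_matchings_eulerian n (H : seq {perm 'I_n}) : eulerian H.
Proof.
move=> v; apply: eq_bigr => M _.
rewrite -(card_preimset [set x | x == v] (@perm_inj _ M)).
by apply: eq_card => x; rewrite !inE.
Qed.

(** Sets of at most half the vertices suffice, since in- and out-cuts agree and a cut is unchanged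
    under complement. *)
Lemma edge_expansion_ge (R : realType) n (H : seq {perm 'I_n}) (c : R) :
  (forall S : {set 'I_n}, (#|S|.*2 <= n)%N -> c * #|S|%:R <= (out_cut H S)%:R) ->
  (c%:E <= edge_expansion R H)%E.
Proof.
move=> cH; rewrite /edge_expansion.
apply: (big_ind (fun x => c%:E <= x)%E) => [|x y cx cy|S /andP[S0 ST]]; first exact: leey.
  by rewrite le_min cx cy.
have cS : (#|S| + #|~: S| = n)%N by rewrite cardsC card_ord.
have S_gt0 : (0 < #|S|)%N by rewrite card_gt0.
have SC_gt0 : (0 < #|~: S|)%N.
  rewrite card_gt0; apply: contra ST => /eqP SC.
  by rewrite -(finset.setCK S) SC finset.setC0.
rewrite lee_fin ler_pdivlMr ?ltr0n ?leq_min ?S_gt0// in_cutE minnn.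
case: (leqP #|S| #|~: S|) => le_card; first by apply: cH; lia.
by rewrite -out_cutC; apply: cH; lia.
Qed.

(** * Sparse sets and the greedy cut player *)

Definition sparse n (h : seq {perm 'I_n}) (S : {set 'I_n}) : bool :=
  (#|S|.*2 <= n)%N && (4 * out_cut h S <= #|S|)%N.

Definition largest_sparse n (h : seq {perm 'I_n}) : {set 'I_n} :=
  [arg max_(S > finset.set0 | sparse h S) #|S|]%N.

Lemma largest_sparseP n (h : seq {perm 'I_n}) :
  sparse h (largest_sparse h) /\
  forall S, sparse h S -> (#|S| <= #|largest_sparse h|)%N.
Proof.
rewrite /largest_sparse; case: arg_maxnP => [|U spU maxU]; last by split.
rewrite /sparse cards0 /=.
by rewrite /out_cut big1 ?muln0// => M _; apply: eq_card0 => x; rewrite !inE.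
Qed.

(** Hence the size of [largest_sparse] never increases during play: if it is at least [n/8] at the
    end, it was so in every earlier round. *)
Lemma sparse_rcons n (h : seq {perm 'I_n}) M S :
  sparse (rcons h M) S -> sparse h S.
Proof. by rewrite /sparse out_cut_rcons => /andP[-> /=]; lia. Qed.

Lemma ex_bisection_sup n (U : {set 'I_n}) :
  ~~ odd n -> (#|U|.*2 <= n)%N ->
  exists B : {set 'I_n}, (U \subset B) && bisection B.
Proof.
move=> evn; move: {2}(n - #|U|)%N (leqnn (n - #|U|)) => k.
elim: k U => [|k IHk] U le_k le_U.
  by exists U; rewrite subxx /bisection; lia.
have [eqU|neqU] := eqVneq #|U|.*2 n.
  by exists U; rewrite subxx /bisection eqU eqxx.
have : (0 < #|~: U|)%N by have := cardsC U; rewrite card_ord; lia.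
case/card_gt0P => x; rewrite inE => xU.
have [||B /andP[sB bB]] := IHk (x |: U); rewrite ?cardsU1 ?xU; try lia.
by exists B; rewrite bB andbT; apply: fintype.subset_trans sB; exact: finset.subsetUr.
Qed.

(** The default is reached only for odd [n], when no bisection exists. *)
Definition greedy_cut n : cut_strategy n := fun h =>
  odflt finset.set0 [pick B : {set 'I_n} | (largest_sparse h \subset B) && bisection B].

Lemma greedy_cutP n (h : seq {perm 'I_n}) : ~~ odd n ->
  (largest_sparse h \subset greedy_cut h) && bisection (greedy_cut h).
Proof.
move=> evn; rewrite /greedy_cut; case: pickP => [B //|noB].
have [/andP[le_U _] _] := largest_sparseP h.
by have [B] := ex_bisection_sup evn le_U; rewrite noB.
Qed.

(** [M] sends [S :&: U] outside [B], hence outside [U]: each image lies outside [S], giving a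
    leaving edge, or in [S :\: U]. *)
Lemma card_leave_matched n (B U S : {set 'I_n}) (M : {perm 'I_n}) :
  U \subset B -> dmatching_between B M ->
  (#|S :&: U| <= #|[set x | (x \in S) && (M x \notin S)]| + #|S :\: U|)%N.
Proof.
move=> /fintype.subsetP sUB /forallP matchM.
have [S1 S2] : #|M @: (S :&: U)| = #|S :&: U| /\
    #|M @: [set x | (x \in S) && (M x \notin S)]| =
    #|[set x | (x \in S) && (M x \notin S)]|.
  by split; apply: card_imset; exact: perm_inj.
rewrite -S1 -S2; apply: leq_trans (leq_card_setU _ _).
apply/subset_leq_card/fintype.subsetP => y /imsetP[x]; rewrite !inE => /andP[xS xU] ->.
case: (boolP (M x \in S)) => MxS; last first.
  by apply/orP; left; apply/imsetP; exists x; rewrite // inE xS.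
apply/orP; right; rewrite andbT; apply/negP => /sUB MxB.
by have := matchM x; rewrite (sUB _ xU) MxB.
Qed.

(* A small set with few leaving edges is either mostly outside [U], and then
   enlarges [U] to a bigger sparse set, or mostly inside [U], and then the last
   matching sends most of it outside. *)
Lemma last_round_expansion n (h : seq {perm 'I_n}) (B S : {set 'I_n}) M :
  largest_sparse h \subset B -> dmatching_between B M ->
  (8 * #|largest_sparse h| < n)%N -> (#|S|.*2 <= n)%N ->
  (#|S| <= 16 * out_cut (rcons h M) S)%N.
Proof.
move=> sUB matchM; have [] := largest_sparseP h.
move: (largest_sparse h) sUB => U sUB /andP[_ spU] maxU ltU leS.
have := card_leave_matched S sUB matchM.
have cU : #|S :|: U| = (#|S :\: U| + #|U|)%N.
  by have := cardsUI S U; have := cardsID U S; lia.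
have cS := cardsID U S.
rewrite out_cut_rcons => leave.
have leU := out_cutU h S U.
rewrite leqNgt; apply/negP => ltS.
have maxS : (#|S| <= #|U|)%N.
  by apply: maxU; rewrite /sparse leS andTb; lia.
(* If [l] edges of [M] leave [S], then [leave] gives [|S| <= l + 2 |S :\: U|], so [ltS] bounds
   [4 * out_cut h S] by [|S :\: U|] and the union is sparse. By maximality [S] lies in [U], and then
   [leave] contradicts [ltS]. *)
suff : (#|S :|: U| <= #|U|)%N by lia.
by apply: maxU; rewrite /sparse cU; apply/andP; split; lia.
Qed.

Lemma legal_play_rcons n (cs : cut_strategy n) T h M :
  legal_play cs T.+1 (rcons h M) ->
  legal_play cs T h /\ dmatching_between (cs h) M.
Proof.
rewrite /legal_play size_rcons => -[[sz] play]; split; last first.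
  by have := play T (ltnSn _); rewrite -sz -cats1 take_size_cat// nth_cat ltnn subnn.
split=> // i iT; have := play i (ltnW iT).
by rewrite -cats1 nth_cat sz iT takel_cat// sz ltnW.
Qed.

(** * Restarting a strategy every [L] rounds *)

Definition in_phases n (L : nat) (cs : cut_strategy n) : cut_strategy n :=
  fun h => cs (drop (size h %/ L * L) h).

Lemma legal_play_in_phases n (cs : cut_strategy n) L K ms : (0 < L)%N ->
  legal_play (in_phases L cs) (K.+1 * L) ms ->
  legal_play (in_phases L cs) (K * L) (take (K * L) ms) /\
  legal_play cs L (drop (K * L) ms).
Proof.
move=> L0 [sz play]; split; split.
- by rewrite size_takel// sz mulSn leq_addl.
- move=> i iK; have := play i; rewrite mulSn => /(_ (ltn_addl _ iK)).
  by rewrite take_takel 1?ltnW// nth_take.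
- by rewrite size_drop sz mulSn addnK.
move=> i iL; have iT : (K * L + i < K.+1 * L)%N by rewrite mulSn addnC ltn_add2r.
have := play _ iT; rewrite /in_phases size_takel ?sz 1?ltnW//.
by rewrite divnMDl// divn_small// addn0 nth_drop take_drop addnC.
Qed.

Lemma out_cut_in_phases n (cs : cut_strategy n) L (S : {set 'I_n}) c d K ms :
  (0 < L)%N ->
  (forall h, legal_play cs L h -> (c <= d * out_cut h S)%N) ->
  legal_play (in_phases L cs) (K * L) ms -> (K * c <= d * out_cut ms S)%N.
Proof.
move=> L0 phase; elim: K ms => [//|K IHK] ms /(legal_play_in_phases L0)[leg1 leg2].
rewrite -(cat_take_drop (K * L) ms) out_cut_cat mulSn mulnDr addnC.
exact: leq_add (IHK _ leg1) (phase _ leg2).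
Qed.

(** * Convexity of [x ln x] *)

Lemma ln_ge1BV (R : realType) (x : R) : 0 < x -> 1 - x^-1 <= ln x.
Proof.
move=> x0; have := @le_ln1Dx R (x^-1 - 1).
rewrite addrCA subrr addr0 lnV ?posrE// => /(_ _) H.
by rewrite lerNl in H; rewrite -opprB; apply: H; rewrite ltrBrDr addNr invr_gt0.
Qed.

Definition xlnx (R : realType) (x : R) : R := x * ln x.

(** The right-hand function [xlnx] is convex; the left side is its tangent line at [s * m]. *)
Lemma xlnx_ge (R : realType) (a m s : R) : 0 <= a -> 0 < m -> 0 < s ->
  a * ln m + a * ln s + a - s * m <= xlnx a.
Proof.
rewrite /xlnx le_eqVlt => /predU1P[<- m0 s0|a0 m0 s0].
  by rewrite !mul0r !add0r oppr_le0 mulr_ge0// ltW.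
have sm0 : 0 < s * m by rewrite mulr_gt0.
have := @ln_ge1BV R (a / (s * m)).
rewrite divr_gt0// => /(_ isT); rewrite ln_div ?posrE// lnM ?posrE// invf_div.
move=> /(ler_wpM2l (ltW a0)); rewrite mulrBr mulr1 mulrCA divff ?gt_eqF//.
by lra.
Qed.

(* Lower bound on the Jensen gap of [x ln x], linear in [a] and [b]. *)
Lemma xlnx_mid (R : realType) (a b s t : R) : 0 <= a -> 0 <= b ->
  0 < s -> 0 < t -> s + t = 2 ->
  2 * xlnx ((a + b) / 2) + a * ln s + b * ln t <= xlnx a + xlnx b.
Proof.
move=> a0 b0 s0 t0 st.
have [ab0|ab0] := eqVneq (a + b) 0.
  have [-> ->] : a = 0 /\ b = 0 by split; lra.
  by rewrite /xlnx addr0 !mul0r !mulr0 !addr0.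
have m0 : 0 < (a + b) / 2 by rewrite divr_gt0// lt_def ab0 addr_ge0.
(* With [m] the mean of [a] and [b], take tangents at [s * m] and [t * m]; since [s + t = 2], the
   terms without logarithm cancel. *)
have := xlnx_ge a0 m0 s0; have := xlnx_ge b0 m0 t0.
have -> : t = 2 - s by lra.
rewrite [xlnx (_ / 2)]/xlnx.
by set l := ln ((a + b) / 2); set ls := ln s; set lt := ln (2 - s); nra.
Qed.

(** * Lazy walks and their leaks *)

(* [walk R h v] is the law of the lazy walk from [v] that uses the matchings of
   [h] in reverse order, so that a new round averages the laws of matched
   vertices. *)
Definition walk (R : realType) n (h : seq {perm 'I_n}) : 'I_n -> 'I_n -> R :=
  foldl (fun p (M : {perm _}) v w => (p v w + p (M v) w) / 2) (fun v w => (v == w)%:R) h.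

Lemma walk_rcons (R : realType) n (h : seq {perm 'I_n}) M v w :
  walk R (rcons h M) v w = (walk R h v w + walk R h (M v) w) / 2.
Proof. by rewrite /walk foldl_rcons. Qed.

Lemma walk_ge0 (R : realType) n (h : seq {perm 'I_n}) v w : 0 <= walk R h v w.
Proof.
elim/last_ind: h v w => [|h M IH] v w; first exact: ler0n.
by rewrite walk_rcons divr_ge0// addr_ge0.
Qed.

Lemma sum_walk (R : realType) n (h : seq {perm 'I_n}) v :
  \sum_w walk R h v w = 1.
Proof.
elim/last_ind: h v => [|h M IH] v.
  by rewrite /walk (bigD1 v)//= eqxx big1 ?addr0// => w; rewrite eq_sym => /negbTE ->.
under eq_bigr do rewrite walk_rcons.
by rewrite -mulr_suml big_split /= !IH; lra.
Qed.

Definition leak (R : realType) n (h : seq {perm 'I_n}) (S : {set 'I_n}) v : R :=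
  \sum_(w in ~: S) walk R h v w.

Lemma leak_ge0 (R : realType) n (h : seq {perm 'I_n}) S v : 0 <= leak R h S v.
Proof. by apply: sumr_ge0 => w _; exact: walk_ge0. Qed.

Lemma sum_walkC (R : realType) n (h : seq {perm 'I_n}) (S : {set 'I_n}) v :
  \sum_(w in S) walk R h v w = 1 - leak R h S v.
Proof.
apply/eqP; rewrite eq_sym subr_eq -(sum_walk R h v) (bigID (mem S)) /=.
by apply/eqP; congr (_ + _); apply: eq_bigl => w; rewrite inE.
Qed.

Lemma leak_le1 (R : realType) n (h : seq {perm 'I_n}) S v : leak R h S v <= 1.
Proof. by rewrite -subr_ge0 -sum_walkC sumr_ge0// => w _; exact: walk_ge0. Qed.

(** In a new round, partners inside [S] contribute distinct terms of the old sum and each partner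
    outside at most 1; averaging halves the total. *)
Lemma sum_leak (R : realType) n (h : seq {perm 'I_n}) (S : {set 'I_n}) :
  \sum_(v in S) leak R h S v <= (out_cut h S)%:R / 2.
Proof.
elim/last_ind: h => [|h M IH].
  rewrite /out_cut big_nil mul0r big1// => v vS; rewrite /leak big1// => w.
  by rewrite inE /walk /=; case: eqP => // <-; rewrite vS.
have -> : \sum_(v in S) leak R (rcons h M) S v =
    (\sum_(v in S) leak R h S v + \sum_(v in S) leak R h S (M v)) / 2.
  rewrite -big_split mulr_suml; apply: eq_bigr => v _.
  rewrite /leak -big_split mulr_suml; apply: eq_bigr => w _.
  exact: walk_rcons.
have le2 : \sum_(v in S) leak R h S (M v) <=
    \sum_(v in S) leak R h S v + #|[set x | (x \in S) && (M x \notin S)]|%:R.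
  rewrite (bigID (fun v => M v \in S)) /= lerD//.
    rewrite [leRHS](reindex_inj (@perm_inj _ M)) /=.
    rewrite [leRHS](bigID (mem S)) /=.
    under eq_bigl do rewrite andbC.
    by rewrite lerDl sumr_ge0// => v _; exact: leak_ge0.
  rewrite -sum1_card natr_sum.
  under [leRHS]eq_bigl do rewrite inE.
  by apply: ler_sum => v _; exact: leak_le1.
rewrite out_cut_rcons natrD; lra.
Qed.

(** * Entropy of the walk laws *)

Definition entropy (R : realType) n (h : seq {perm 'I_n}) : R :=
  - \sum_v \sum_w xlnx (walk R h v w).

Lemma entropy_ge0 (R : realType) n (h : seq {perm 'I_n}) : 0 <= entropy R h.
Proof.
rewrite oppr_ge0 sumr_le0// => v _; rewrite sumr_le0// => w _.
rewrite /xlnx mulr_ge0_le0 ?walk_ge0// ln_le0// -(sum_walk R h v).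
by rewrite (bigD1 w)//= lerDl sumr_ge0// => u _; exact: walk_ge0.
Qed.

Lemma entropy_le (R : realType) n (h : seq {perm 'I_n}) : (0 < n)%N ->
  entropy R h <= n%:R * ln n%:R.
Proof.
move=> n_gt0; have n0 : 0 < n%:R :> R by rewrite ltr0n.
have row v : - ln n%:R <= \sum_w xlnx (walk R h v w).
  have -> : - ln n%:R = \sum_w (walk R h v w * ln n%:R^-1 + walk R h v w - n%:R^-1).
    rewrite sumrB big_split /= -mulr_suml sum_walk sumr_const card_ord.
    by rewrite lnV ?posrE// mul1r -(mulr_natl n%:R^-1) divff ?gt_eqF// addrK.
  apply: ler_sum => w _.
  have nV0 : 0 < n%:R^-1 :> R by rewrite invr_gt0.
  (* Tangent at the uniform value [1/n]. *)
  have := xlnx_ge (walk_ge0 R h v w) nV0 ltr01.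
  by rewrite ln1 mulr0 addr0 mul1r.
rewrite /entropy lerNl mulr_natl -mulNrn.
rewrite -[X in _ *+ X](card_ord n) -sumr_const.
by apply: ler_sum => v _; exact: row.
Qed.

(* With [s = 3/2, t = 1/2] in [xlnx_mid] on [S] (swapped off [S]) the gain is
   linear in the leaks of the two matched laws. *)
Lemma entropy_gain (R : realType) n (h : seq {perm 'I_n}) (B S : {set 'I_n}) M :
  S \subset B -> dmatching_between B M ->
  entropy R h + #|S|%:R * ln (3 / 2) - (out_cut h S)%:R * (ln 3 / 2)
  <= entropy R (rcons h M).
Proof.
move=> /fintype.subsetP sSB /forallP matchM.
pose a : R := ln (3 / 2); pose b : R := ln (1 / 2).
have ab : a - b = ln 3.
  by rewrite /a /b -ln_div ?posrE ?divr_gt0//; congr ln; field.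
pose row v := \sum_w xlnx (walk R h v w).
pose row' v := \sum_w xlnx (walk R (rcons h M) v w).
pose L v := leak R h S v; pose L' v := leak R h (~: S) v.
have two : 3 / 2 + 1 / 2 = 2 :> R by field.
have s0 : 0 < 3 / 2 :> R by rewrite divr_gt0.
have t0 : 0 < 1 / 2 :> R by rewrite divr_gt0.
(* Equal weights [s = t = 1]: rows outside [S] lose nothing. *)
have gain0 v : 2 * row' v <= row v + row (M v).
  rewrite /row' /row mulr_sumr -big_split; apply: ler_sum => w _ /=.
  rewrite walk_rcons.
  have := xlnx_mid (walk_ge0 R h v w) (walk_ge0 R h (M v) w) ltr01 ltr01 (erefl _).
  by rewrite ln1 !mulr0 !addr0.
have splitS F : \sum_w F w = \sum_(w in S) F w + \sum_(w in ~: S) F w :> R.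
  rewrite (bigID (mem S)) /=; congr (_ + _).
  by apply: eq_bigl => w; rewrite inE.
have gainS v : 2 * row' v + 2 * a <= row v + row (M v) + (a - b) * (L v + L' (M v)).
  have eS : \sum_(w in S) walk R h v w = 1 - L v by exact: sum_walkC.
  have eSC : \sum_(w in ~: S) walk R h v w = L v by [].
  have eS' : \sum_(w in S) walk R h (M v) w = L' (M v) by rewrite /L' /leak finset.setCK.
  have eSC' : \sum_(w in ~: S) walk R h (M v) w = 1 - L' (M v) by exact: sum_walkC.
  have onS : 2 * (\sum_(w in S) xlnx (walk R (rcons h M) v w)) + (1 - L v) * a
      + L' (M v) * b
      <= \sum_(w in S) xlnx (walk R h v w) + \sum_(w in S) xlnx (walk R h (M v) w).
    rewrite -eS -eS' mulr_sumr !mulr_suml -!big_split; apply: ler_sum => w _ /=.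
    by rewrite walk_rcons; apply: xlnx_mid; rewrite ?walk_ge0.
  have offS : 2 * (\sum_(w in ~: S) xlnx (walk R (rcons h M) v w)) + L v * b
      + (1 - L' (M v)) * a
      <= \sum_(w in ~: S) xlnx (walk R h v w)
         + \sum_(w in ~: S) xlnx (walk R h (M v) w).
    rewrite -eSC -eSC' mulr_sumr !mulr_suml -!big_split; apply: ler_sum => w _ /=.
    by rewrite walk_rcons; apply: xlnx_mid; rewrite ?walk_ge0// addrC.
  by rewrite /row' /row !splitS; lra.
have leakS : \sum_(v in S) L v <= (out_cut h S)%:R / 2 by exact: sum_leak.
(* As [S] lies in [B], [M] maps it injectively into its complement, so this is a partial sum of the
   leaks of [~: S]. *)
have leakSC : \sum_(v in S) L' (M v) <= (out_cut h S)%:R / 2.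
  rewrite -out_cutC; apply: le_trans (sum_leak R h (~: S)).
  rewrite [leRHS](reindex_inj (@perm_inj _ M)) /=.
  rewrite [leRHS](bigID (mem S)) /=.
  rewrite [X in _ <= X + _](eq_bigl (mem S)); last first.
    move=> v; rewrite inE /= andbC; case: (boolP (v \in S)) => //= vS.
    apply/negP => /sSB MvB; have := matchM v.
    by rewrite (sSB _ vS) MvB.
  by rewrite lerDl sumr_ge0// => v _; exact: leak_ge0.
have sumM : \sum_v row (M v) = \sum_v row v.
  by rewrite [RHS](reindex_inj (@perm_inj _ M)).
have total : 2 * (\sum_v row' v) + #|S|%:R * (2 * a) <=
    \sum_v row v + \sum_v row (M v)
    + (a - b) * (\sum_(v in S) L v + \sum_(v in S) L' (M v)).
  rewrite [\sum_v row' v]splitS [\sum_v row v]splitS [\sum_v row (M v)]splitS.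
  have onS : 2 * (\sum_(v in S) row' v) + #|S|%:R * (2 * a) <=
      \sum_(v in S) row v + \sum_(v in S) row (M v)
      + (a - b) * (\sum_(v in S) L v + \sum_(v in S) L' (M v)).
    have -> : (a - b) * (\sum_(v in S) L v + \sum_(v in S) L' (M v)) =
        \sum_(v in S) (a - b) * (L v + L' (M v)) by rewrite -big_split mulr_sumr.
    rewrite [#|S|%:R * _]mulr_natl -sumr_const mulr_sumr -!big_split.
    by apply: ler_sum => v _ /=.
  have offS : 2 * (\sum_(v in ~: S) row' v) <=
      \sum_(v in ~: S) row v + \sum_(v in ~: S) row (M v).
    by rewrite mulr_sumr -big_split; apply: ler_sum => v _ /=.
  by lra.
have ln3 : 0 <= ln 3 :> R by rewrite ln_ge0// ler1n.
have : ln 3 * (\sum_(v in S) L v + \sum_(v in S) L' (M v)) <= ln 3 * (out_cut h S)%:R.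
  by rewrite ler_wpM2l//; lra.
move: total; rewrite ab sumM /entropy -/a.
rewrite -[\sum_v \sum_w xlnx (walk R h v w)]/(\sum_v row v).
rewrite -[\sum_v \sum_w xlnx (walk R (rcons h M) v w)]/(\sum_v row' v).
by set X := \sum_v row v; set Y := \sum_v row' v; lra.
Qed.

(** * Length of a phase and the final count *)

Lemma greedy_entropy (R : realType) n (h : seq {perm 'I_n}) : ~~ odd n ->
  legal_play (@greedy_cut n) (size h) h -> (n <= 8 * #|largest_sparse h|)%N ->
  (size h)%:R * (n%:R / 48) <= entropy R h.
Proof.
move=> evn; elim/last_ind: h => [|h M IH]; first by rewrite mul0r entropy_ge0.
rewrite size_rcons => /legal_play_rcons[legh matchM] big.
have [spU maxU] := largest_sparseP h.
have bigh : (n <= 8 * #|largest_sparse h|)%N.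
  apply: leq_trans big _; rewrite leq_mul2l /=; apply: maxU.
  by apply: (@sparse_rcons _ _ M); case: (largest_sparseP (rcons h M)).
have {}IH := IH legh bigh.
have /andP[sUB _] := greedy_cutP h evn.
have := entropy_gain R h sUB matchM.
case/andP: spU => _; move: bigh.
set s := #|_|; set o := out_cut _ _ => bigh spU gain.
have : n%:R <= 8 * s%:R :> R by rewrite -natrM ler_nat.
have : 4 * o%:R <= s%:R :> R by rewrite -natrM ler_nat.
have : 1 / 3 <= ln (3 / 2) :> R.
  by apply: le_trans (ln_ge1BV _); lra.
(* Because [3 <= (3/2)^4]. *)
have l34 : ln 3 <= 4 * ln (3 / 2) :> R.
  rewrite mulr_natl -lnXn ?divr_gt0// ler_ln ?posrE ?exprn_gt0 ?divr_gt0//; lra.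
have l3 : 0 <= ln 3 :> R by rewrite ln_ge0// ler1n.
have o0 : 0 <= o%:R :> R by exact: ler0n.
have s0 : 0 <= s%:R :> R by exact: ler0n.
move: gain l34 l3; set l := ln (3 / 2); set k := ln 3 => gain l34 l3 l13 os ns.
(* The loss is at most half the gain, leaving [s * l / 2 >= s / 6 >= n / 48] per round. *)
have : o%:R * (k / 2) <= s%:R * l / 2.
  apply: (@le_trans _ _ (s%:R / 4 * (k / 2))); first by apply: ler_wpM2r; lra.
  have := ler_wpM2l s0 l34; lra.
have := ler_wpM2l s0 l13.
rewrite -[(size h).+1%:R]natr1 mulrDl mul1r; lra.
Qed.

(** Were the largest sparse set still of size [n/8] after [m] rounds, the entropy would exceed
    [n ln n]; round [m.+1] is the expanding one. *)
Lemma greedy_phase (R : realType) n m (h : seq {perm 'I_n}) (S : {set 'I_n}) :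
  ~~ odd n -> (0 < n)%N -> 48 * ln n%:R < m%:R :> R ->
  legal_play (@greedy_cut n) m.+1 h -> (#|S|.*2 <= n)%N ->
  (#|S| <= 16 * out_cut h S)%N.
Proof.
move=> evn n0 ltm; case/lastP: h => [[]//|h M] leg leS.
have {leg} [legh matchM] := legal_play_rcons leg.
have /andP[sUB _] := greedy_cutP h evn.
apply: last_round_expansion sUB matchM _ leS; rewrite ltnNge; apply/negP => big.
have szh : size h = m by case: legh.
rewrite -szh in legh ltm.
have := le_trans (greedy_entropy R evn legh big) (entropy_le R h n0).
rewrite mulrCA ler_pM2l ?ltr0n//; lra.
Qed.

Theorem mainTheorem5 (R : realType) :
  exists (c1 c2 : R) (n0 : nat), 0 < c1 /\ 0 < c2 /\
  forall n : nat, ~~ odd n -> (n0 <= n)%N ->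
  exists (cs : cut_strategy n) (T : nat),
    (forall h, bisection (cs h)) /\
    T%:R <= c1 * (ln (n%:R : R)) ^+ 2 /\
    forall ms : seq {perm 'I_n}, legal_play cs T ms ->
      eulerian ms /\ ((c2 * ln (n%:R : R))%:E <= edge_expansion R ms)%E.
Proof.
(* With [ln n >= 1/2], [m <= 50 ln n] and [m.+1 <= 52 ln n], whose product gives 2600. Each of
   [m >= 48 ln n] phases adds [|S| / 16] to the cut, and [48 / 16 = 3]. *)
exists 2600, 3, 2%N; do 2![split; first exact: ltr0n] => n evn n2.
have n0 : (0 < n)%N by exact: ltnW.
have x2 : 1 / 2 <= ln n%:R :> R.
  apply: le_trans (ln_ge1BV _); last by rewrite ltr0n.
  have : n%:R^-1 <= 2^-1 :> R by rewrite lef_pV2 ?posrE ?ltr0n// ler_nat.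
  by lra.
pose m := (Num.truncn (48 * ln (n%:R : R))).+1.
have ltm : 48 * ln n%:R < m%:R :> R by exact: truncnS_gt.
have lem : m%:R <= 48 * ln n%:R + 1 :> R.
  by rewrite -[m%:R]natr1 lerD2r truncn_le; lra.
(* [m] phases of [m.+1] rounds each. *)
exists (in_phases m.+1 (@greedy_cut n)), (m * m.+1)%N; split; [|split].
- by move=> h; case/andP: (greedy_cutP (drop (size h %/ m.+1 * m.+1) h) evn).
- rewrite natrM -[m.+1%:R]natr1; apply: (@le_trans _ _ ((50 * ln n%:R) * (52 * ln n%:R))).
    by apply: ler_pM; lra.
  by rewrite expr2; lra.
move=> ms leg; split; first exact: union_of_matchings_eulerian.
apply: edge_expansion_ge => S leS.
have phase h : legal_play (@greedy_cut n) m.+1 h -> (#|S| <= 16 * out_cut h S)%N.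
  by move=> legh; exact: greedy_phase ltm legh leS.
have := out_cut_in_phases (ltn0Sn m) phase leg.
rewrite -(ler_nat R) !natrM => le_out.
have := ler_wpM2r (ler0n R #|S|) (ltW ltm).
lra.
Qed.
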